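(* For all integers $J\ge 0$ and $N\ge 0$, $$MO(0,27J+26;27N+26)\equiv 0\pmod 3.$$
   Context: For an integer $a$ and a nonnegative integer $t$, define $MO(a,t;n)$ by the formal power series identity $$\sum_{n\ge 0}MO(a,t;n)\,q^n=\sum_{1\le n_1<n_2<\cdots<n_t}\frac{q^{n_1+n_2+\cdots+n_t}}{\prod_{k=1}^t(1+aq^{n_k}+q^{2n_k})},$$ where each factor $1/(1+aq^{m}+q^{2m})$ is expanded as a power series in $q$ with integer coefficients. *)

(* Defs.v *)
From HB Require Import structures.
From mathcomp Require Import all_boot all_order all_algebra.
From mathcomp Require Import finmap.
From mathcomp Require Import boolp classical_sets functions cardinality fsbigop.

Set Implicit Arguments.
Unset Strict Implicit.
Unset Printing Implicit Defensive.

Import Order.TTheory GRing.Theory Num.Theory.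

Local Open Scope classical_set_scope.
Local Open Scope ring_scope.

Declare Scope fps_scope.

(* Formal power series over R. A record rather than a bare function type, so
   that the Cauchy product cannot be confused with the pointwise product that
   MathComp-Analysis puts on functions. *)
Record fps (R : Type) := Fps { fps_coef :> nat -> R }.

Lemma fpsP (R : Type) (f g : fps R) : (forall n, f n = g n) <-> f = g.
Proof.
split=> [|-> //]; case: f g => f [g] /= fg; congr Fps; exact/funext.
Qed.

HB.instance Definition _ (R : Type) := gen_eqMixin (fps R).
HB.instance Definition _ (R : Type) := gen_choiceMixin (fps R).

Section FpsZmodule.
Variable R : zmodType.
Implicit Types f g h : fps R.

Definition fps_zero : fps R := Fps (fun=> 0).
Definition fps_opp f : fps R := Fps (fun n => - f n).
Definition fps_add f g : fps R := Fps (fun n => f n + g n).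

Fact fps_addA : associative fps_add.
Proof. by move=> f g h; apply/fpsP => n /=; rewrite addrA. Qed.
Fact fps_addC : commutative fps_add.
Proof. by move=> f g; apply/fpsP => n /=; rewrite addrC. Qed.
Fact fps_add0 : left_id fps_zero fps_add.
Proof. by move=> f; apply/fpsP => n /=; rewrite add0r. Qed.
Fact fps_addN : left_inverse fps_zero fps_opp fps_add.
Proof. by move=> f; apply/fpsP => n /=; rewrite addNr. Qed.

HB.instance Definition _ := GRing.isZmodule.Build (fps R)
  fps_addA fps_addC fps_add0 fps_addN.

Lemma fps_coef0 n : (0 : fps R) n = 0. Proof. by []. Qed.
Lemma fps_coefD f g n : (f + g) n = f n + g n. Proof. by []. Qed.
Lemma fps_coefN f n : (- f) n = - f n. Proof. by []. Qed.

End FpsZmodule.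

Section FpsRing.
Variable R : comNzRingType.
Implicit Types f g h : fps R.

Definition fps_one : fps R := Fps (fun n => (n == 0%N)%:R).
Definition fps_mul f g : fps R :=
  Fps (fun n => \sum_(i < n.+1) f i * g (n - i)%N).

Definition fps_trunc m f : {poly R} := \poly_(i < m.+1) f i.

Lemma fps_mul_trunc m n f g : (n <= m)%N ->
  fps_mul f g n = (fps_trunc m f * fps_trunc m g)`_n.
Proof.
move=> nm; rewrite coefM; apply: eq_bigr => i _.
have im : (i <= n)%N by rewrite -ltnS.
rewrite !coef_poly !ltnS (leq_trans im nm).
by rewrite (leq_trans (leq_subr _ _) nm).
Qed.

Fact fps_mulC : commutative fps_mul.
Proof.
by move=> f g; apply/fpsP => n; rewrite !(@fps_mul_trunc n) // mulrC.
Qed.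

Fact fps_mulA : associative fps_mul.
Proof.
move=> f g h; apply/fpsP => n /=.
transitivity ((fps_trunc n f * (fps_trunc n g * fps_trunc n h))`_n).
  rewrite coefM; apply: eq_bigr => i _.
  have im : (i <= n)%N by rewrite -ltnS.
  by rewrite coef_poly ltnS im -(@fps_mul_trunc n) // leq_subr.
rewrite mulrA coefM; apply: eq_bigr => i _.
have im : (i <= n)%N by rewrite -ltnS.
rewrite [X in _ * X = _]coef_poly ltnS leq_subr.
by rewrite -(@fps_mul_trunc n).
Qed.

Fact fps_mul1 : left_id fps_one fps_mul.
Proof.
move=> f; apply/fpsP => n /=; rewrite big_ord_recl /= mul1r subn0.
by rewrite big1 ?addr0 // => i _; rewrite mul0r.
Qed.

Fact fps_mulD : left_distributive fps_mul (@fps_add R).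
Proof.
move=> f g h; apply/fpsP => n /=; rewrite -big_split /=.
by apply: eq_bigr => i _; rewrite mulrDl.
Qed.

Fact fps_one_neq0 : fps_one != 0 :> fps R.
Proof.
apply/eqP => /fpsP /(_ 0%N) /= /eqP; exact/negP/oner_neq0.
Qed.

HB.instance Definition _ := GRing.Zmodule_isComNzRing.Build (fps R)
  fps_mulA fps_mulC fps_mul1 fps_mulD fps_one_neq0.

Lemma fps_coef1 n : (1 : fps R) n = (n == 0%N)%:R. Proof. by []. Qed.
Lemma fps_coefM f g n : (f * g) n = \sum_(i < n.+1) f i * g (n - i)%N.
Proof. by []. Qed.

(* The variable q. *)
Definition fps_var : fps R := Fps (fun n => (n == 1%N)%:R).

Lemma fps_coefXM f n : (fps_var * f) n = if n is m.+1 then f m else 0.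
Proof.
rewrite fps_coefM big_ord_recl /= mul0r add0r.
case: n => [|n]; first by rewrite big_ord0.
rewrite big_ord_recl /= mul1r subn1 big1 ?addr0 // => i _.
by rewrite mul0r.
Qed.

Lemma fps_coefXnM m f n :
  (fps_var ^+ m * f) n = if (m <= n)%N then f (n - m)%N else 0.
Proof.
elim: m n => [|m IHm] n; first by rewrite expr0 mul1r subn0.
by rewrite exprS -mulrA fps_coefXM; case: n => [|n] //; rewrite IHm.
Qed.

Lemma fps_coefXn m n : (fps_var ^+ m) n = (n == m)%:R.
Proof.
rewrite -[_ ^+ m]mulr1 fps_coefXnM fps_coef1; case: leqP => [mn|nm].
  by rewrite subn_eq0 eqn_leq mn andbT.
by rewrite (ltn_eqF nm).
Qed.

End FpsRing.

Notation "''q'" := (fps_var _) (at level 0, format "''q'") : fps_scope.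
Local Open Scope fps_scope.

Section FpsUnitRing.
Variable R : comUnitRingType.
Implicit Types f g : fps R.

Definition fps_unit : {pred fps R} := fun f => f 0%N \is a GRing.unit.

(* The list of the first n + 1 coefficients of 1 / f, from
   f_0 g_0 = 1 and f_0 g_n = - (f_1 g_(n-1) + ... + f_n g_0). *)
Fixpoint fps_inv_seq f n : seq R :=
  if n is m.+1 then
    let s := fps_inv_seq f m in
    rcons s (- (f 0%N)^-1 * \sum_(i < m.+1) f i.+1 * s`_(m - i)%N)
  else [:: (f 0%N)^-1].

Definition fps_inv f : fps R :=
  if f \in fps_unit then Fps (fun n => (fps_inv_seq f n)`_n) else f.

Lemma size_fps_inv_seq f n : size (fps_inv_seq f n) = n.+1.
Proof. by elim: n => //= n IHn; rewrite size_rcons IHn. Qed.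

Lemma nth_fps_inv_seq f m n : (n <= m)%N ->
  (fps_inv_seq f m)`_n = (fps_inv_seq f n)`_n.
Proof.
elim: m => [|m IHm]; first by rewrite leqn0 => /eqP ->.
rewrite leq_eqVlt => /orP[/eqP -> // | nm].
by rewrite [fps_inv_seq f m.+1]/= nth_rcons size_fps_inv_seq nm IHm.
Qed.

Fact fps_mulVf : {in fps_unit, left_inverse 1 fps_inv *%R}.
Proof.
move=> f fU; rewrite mulrC /fps_inv fU; apply/fpsP => -[|n].
  by rewrite fps_coefM big_ord_recl big_ord0 addr0 /= divrr.
rewrite fps_coefM big_ord_recl [LHS]/= nth_rcons size_fps_inv_seq ltnn eqxx.
rewrite mulrA mulrN divrr // mulN1r addrC; apply/eqP; rewrite subr_eq add0r.
apply/eqP/eq_bigr => i _; rewrite /bump /= add1n subSS.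
by rewrite (nth_fps_inv_seq f (leq_subr i n)).
Qed.

Fact fps_unitPl f g : g * f = 1 -> fps_unit f.
Proof.
move=> /fpsP /(_ 0%N); rewrite fps_coefM big_ord_recl big_ord0 addr0 /= => gf.
by apply/unitrPr; exists (g 0%N); rewrite mulrC.
Qed.

Fact fps_inv_out : {in [predC fps_unit], fps_inv =1 id}.
Proof. by move=> f; rewrite inE /= /fps_inv => /negbTE ->. Qed.

HB.instance Definition _ := GRing.ComNzRing_hasMulInverse.Build (fps R)
  fps_mulVf fps_unitPl fps_inv_out.

Lemma fps_unitE f : (f \is a GRing.unit) = (f 0%N \is a GRing.unit).
Proof. by []. Qed.

End FpsUnitRing.

(* Sum of a family of power series such that each coefficient is nonzero for
   only finitely many members of the family. *)
Definition fps_sum (R : zmodType) (I : choiceType) (A : set I)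
    (F : I -> fps R) : fps R :=
  Fps (fun n => \sum_(i \in A) F i n).

(* The tuples (n_1, ..., n_t) with 1 <= n_1 < ... < n_t. *)
Definition MO_index (t : nat) : set (t.-tuple nat) :=
  [set w : t.-tuple nat | path ltn 0%N w].

Definition MO_denom (a : int) (m : nat) : fps int :=
  1 + a%:~R * 'q ^+ m + 'q ^+ (2 * m)%N.

Definition MO_term (a : int) (t : nat) (w : t.-tuple nat) : fps int :=
  'q ^+ (\sum_(k < t) tnth w k)%N / \prod_(k < t) MO_denom a (tnth w k).

Definition MO_gf (a : int) (t : nat) : fps int :=
  fps_sum (@MO_index t) (@MO_term a t).

Definition MO (a : int) (t n : nat) : int := MO_gf a t n.

(* Well-definedness: every factor is invertible, and for each n only finitely
   many tuples contribute to the coefficient of q^n. *)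
Lemma MO_denom_unit a m : (0 < m)%N -> MO_denom a m \is a GRing.unit.
Proof.
move=> m0; rewrite fps_unitE /MO_denom !fps_coefD [a%:~R * _]mulrC.
by rewrite fps_coefXnM fps_coefXn leqNgt m0 addr0 eq_sym muln_eq0 (gtn_eqF m0).
Qed.

Lemma MO_term_coef_eq0 a t (w : t.-tuple nat) n :
  (n < \sum_(k < t) tnth w k)%N -> MO_term a w n = 0.
Proof. by move=> nw; rewrite /MO_term fps_coefXnM leqNgt nw. Qed.

Lemma MO_term_locally_finite a t n :
  finite_set [set w | MO_index w /\ @MO_term a t w n <> 0].
Proof.
pose g (v : t.-tuple 'I_n.+1) : t.-tuple nat := [tuple of map val v].
have fing : finite_set (range g) by apply: finite_image; exact: finite_finset.
apply: sub_finite_set fing => w [_ wn0].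
have wn k : (tnth w k <= n)%N.
  rewrite leqNgt; apply/negP => nk; apply: wn0.
  apply: MO_term_coef_eq0; apply: leq_trans nk _.
  by rewrite (bigD1 k) //= leq_addr.
exists [tuple inord (tnth w k) | k < t] => //.
apply: eq_from_tnth => k; rewrite tnth_map tnth_mktuple.
by rewrite /= inordK // ltnS.
Qed.

(* Main.v *)
Require Import Defs.
From mathcomp Require Import all_boot all_order all_algebra.
From mathcomp Require Import boolp classical_sets functions cardinality fsbigop.
From mathcomp Require Import ring zify.

(* Summing over t, the series of MO(0,t) have the generating function
     prod_(n >= 1) (1 + z q^n + q^(2n)) / (1 + q^(2n)),
   whose numerator is, by the Jacobi triple product and up to a factor that does
   not involve z, the series sum_n P_n(z) q^(n(n+1)/2) with P_0 = 1,
   P_1 = z - 1, P_(n+2) = z P_(n+1) - P_n. Comparing with z = 0, and writing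
   Theta_t for the coefficient of z^t in that series and psi = Theta_0,
     psi * sum_n MO(0,t;n) q^n = Theta_t.
   The coefficient of z^t in sum_n P_n(z) y^n is (1 - y) y^t / (1 + y^2)^(t+1);
   for t = 26 mod 27 the denominator is a series in y^27 mod 3, so only
   n = 0, 26 mod 27 contribute to Theta_t, and Theta_t is a series in q^27, hence
   a 27th power mod 3. Finally mod 3 the terms of psi with exponent 1 mod 3 sum
   to -q psi(q^9) = -q psi^9 and there is no exponent 2 mod 3, so that passing
   three times to the exponents 2 mod 3 in the displayed equation
   leaves zero. *)

Set Implicit Arguments.
Unset Strict Implicit.
Unset Printing Implicit Defensive.

Import GRing.Theory.

Local Open Scope ring_scope.
Local Open Scope fps_scope.

(** * Theta series *)

Definition tri (n : nat) : nat := 'C(n.+1, 2).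

Lemma triS n : tri n.+1 = (tri n + n.+1)%N.
Proof. by rewrite /tri binS bin1. Qed.

Lemma double_tri n : (2 * tri n = n * n.+1)%N.
Proof. elim: n => // n IHn; rewrite triS; lia. Qed.

Lemma leq_tri n : (n <= tri n)%N.
Proof. by have := double_tri n; nia. Qed.

Lemma tri_inj : injective tri.
Proof. by move=> m n mn; have := double_tri m; have := double_tri n; nia. Qed.

(* The series [sum_n c_n q^(tri n)]; terms with [n > k] do not reach [q^k]. *)
Definition theta (R : nzRingType) (c : nat -> R) : fps R :=
  Fps (fun k => \sum_(n < k.+1) c n * (k == tri n)%:R).

Lemma theta_tri (R : nzRingType) (c : nat -> R) n : theta c (tri n) = c n.
Proof.
rewrite /= (bigD1 (inord n)) //= inordK ?ltnS ?leq_tri // eqxx mulr1 big1 ?addr0 //.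
move=> i ni; case: eqP => [/tri_inj nE|_]; last by rewrite mulr0.
by case/eqP: ni; apply/val_inj; rewrite /= inordK ?ltnS ?leq_tri.
Qed.

Lemma theta_eq0 (R : nzRingType) (c : nat -> R) k :
  (forall n, k = tri n -> c n = 0) -> theta c k = 0.
Proof.
move=> ck; rewrite /= big1 // => n _.
by case: eqP => [/ck ->|_]; rewrite ?mul0r ?mulr0.
Qed.

Lemma theta_widen (R : nzRingType) (c : nat -> R) k m : (k <= m)%N ->
  theta c k = \sum_(n < m.+1) c n * (k == tri n)%:R.
Proof.
move=> km; rewrite /= (big_ord_widen m.+1 (fun n => c n * (k == tri n)%:R)) //.
rewrite big_mkcond /=; apply: eq_bigr => n _; case: ifP => // /negbT.
rewrite -leqNgt => kn; rewrite ltn_eqF ?mulr0 //.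
exact: leq_trans kn (leq_tri n).
Qed.

(** * Power series over the field with three elements *)

Section CharacteristicThree.
Implicit Types f g h a b c : fps 'F_3.

Lemma fps_three : 3%:R = 0 :> fps 'F_3.
Proof.
apply/fpsP => n; rewrite (_ : (3%:R : fps 'F_3) n = (1 : fps 'F_3) n *+ 3) //.
by rewrite -mulr_natr (_ : 3%:R = 0 :> 'F_3) ?mulr0 //; apply/val_inj.
Qed.

Lemma cubeD f g : (f + g) ^+ 3 = f ^+ 3 + g ^+ 3.
Proof.
have -> : (f + g) ^+ 3 = f ^+ 3 + g ^+ 3 + 3%:R * (f ^+ 2 * g + f * g ^+ 2) by ring.
by rewrite fps_three mul0r addr0.
Qed.

Definition dissect (r : nat) f : fps 'F_3 := Fps (fun n => f (3 * n + r)%N).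

(** Frobenius: cubing fixes the field with three elements, so f^3 = f(q^3). The induction strips off
    the constant term, f = c + q g. *)
Lemma fps_coef_cube f n :
  (f ^+ 3) n = if (3 %| n)%N then f (n %/ 3)%N else 0.
Proof.
elim/ltn_ind: n f => n IHn f.
pose c : fps 'F_3 := Fps (fun n => if n is 0%N then f 0%N else 0).
pose g : fps 'F_3 := Fps (fun n => f n.+1).
have cM h k : (c * h) k = f 0%N * h k.
  by rewrite fps_coefM big_ord_recl subn0 big1 ?addr0 // => i _; rewrite mul0r.
have c3 : c ^+ 3 = c.
  apply/fpsP => k; rewrite exprS expr2 !cM; case: k => [|k]; last by rewrite !mulr0.
  by rewrite /=; case: (f 0%N) => -[|[|[|]]] // i; apply/val_inj.
have -> : f = c + 'q * g.
  by apply/fpsP => k; rewrite fps_coefD fps_coefXM; case: k => [|k] /=;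
      rewrite ?addr0 ?add0r.
rewrite cubeD c3 exprMn !fps_coefD fps_coefXnM fps_coefXM.
case: (leqP 3 n) => n3; last first.
  by rewrite addr0; move: n3; clear; case: n => [|[|[|n]]] // _; apply/esym/addr0.
rewrite IHn; last lia.
have -> : (3 %| n - 3)%N = (3 %| n)%N by lia.
have -> : (n %/ 3 = ((n - 3) %/ 3).+1)%N by lia.
have -> : c n = 0 by case: n n3 {IHn}.
by rewrite add0r; case: ifP => // _; apply/esym/add0r.
Qed.

Lemma coef_cubes a b c n :
  (a ^+ 3 + 'q * b ^+ 3 + 'q ^+ 2 * c ^+ 3) n =
  (if n %% 3 == 0 then a else if n %% 3 == 1 then b else c)%N (n %/ 3)%N.
Proof.
rewrite !fps_coefD fps_coefXM fps_coefXnM fps_coef_cube.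
case: n => [|[|n]]; first by rewrite !fps_coef_cube /= !addr0.
  by rewrite !fps_coef_cube /= add0r addr0.
rewrite !fps_coef_cube [(1 < n.+2)%N]/= !subSS subn0.
have := ltn_pmod n.+2 (isT : 0 < 3)%N.
case En: (n.+2 %% 3)%N => [|[|[|]]] // _ /=.
- have [-> -> ->] : [/\ (3 %| n.+2) = true, (3 %| n.+1) = false & (3 %| n) = false]%N.
    by split; lia.
  by rewrite !addr0.
- have [-> -> ->] : [/\ (3 %| n.+2) = false, (3 %| n.+1) = true & (3 %| n) = false]%N.
    by split; lia.
  rewrite addr0 add0r; congr (fps_coef b _); lia.
- have [-> -> ->] : [/\ (3 %| n.+2) = false, (3 %| n.+1) = false & (3 %| n) = true]%N.
    by split; lia.
  rewrite !add0r; congr (fps_coef c _); lia.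
Qed.

Lemma dissectK f :
  f = dissect 0 f ^+ 3 + 'q * dissect 1 f ^+ 3 + 'q ^+ 2 * dissect 2 f ^+ 3.
Proof.
apply/fpsP => n; rewrite coef_cubes.
have := ltn_pmod n (isT : 0 < 3)%N.
by case En: (n %% 3)%N => [|[|[|]]] // _ /=; congr (fps_coef f _); lia.
Qed.

Lemma dissect2_cubes a b c :
  dissect 2 (a ^+ 3 + 'q * b ^+ 3 + 'q ^+ 2 * c ^+ 3) = c.
Proof.
apply/fpsP => n; transitivity ((a ^+ 3 + 'q * b ^+ 3 + 'q ^+ 2 * c ^+ 3) (3
    * n + 2)%N) => //.
rewrite coef_cubes; have -> : ((3 * n + 2) %% 3 = 2)%N by lia.
by rewrite /=; congr (fps_coef c _); lia.
Qed.

(** A cube is a series in q^3, so it acts on each class of exponents mod 3 separately. *)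
Lemma dissect2_cubeM g f : dissect 2 (g ^+ 3 * f) = g * dissect 2 f.
Proof.
rewrite {1}(dissectK f).
set a := dissect 0 f; set b := dissect 1 f; set c := dissect 2 f.
rewrite -(dissect2_cubes (g * a) (g * b) (g * c)).
by congr (dissect 2 _); ring.
Qed.

Lemma cube_support f : (forall n, ~~ (3 %| n)%N -> f n = 0) ->
  f = Fps (fun n => f (3 * n)%N) ^+ 3.
Proof.
move=> f0; apply/fpsP => n; rewrite fps_coef_cube /=.
by case: ifPn => [n3|/f0 //]; rewrite mulnC divnK.
Qed.

(* Multiplying [psi f = k^3] by [psi^2] gives [psi(q^3) f = psi^2 k^3], and
   extracting the exponents [3n+2] from it gives [psi (dissect 2 f) = psi^6 k];
   the right-hand side is again a cube as long as [k] is one. *)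
Section Cascade.
Variable psi : fps 'F_3.
Hypothesis psi1 : dissect 1 psi = - psi ^+ 3.
Hypothesis psi2 : dissect 2 psi = 0.
Hypothesis psi_unit : psi \is a GRing.unit.

Lemma dissect2_psi_sqr : dissect 2 (psi ^+ 2) = psi ^+ 6.
Proof.
have psiE := dissectK psi; rewrite psi1 psi2 in psiE.
set a := dissect 0 psi in psiE.
rewrite -(dissect2_cubes (a ^+ 2) (- (2%:R * a * psi ^+ 3)) (psi ^+ 6)).
congr (dissect 2 _); rewrite [in LHS]psiE.
(* The cross term of the square must be q times a cube, including its coefficient: 2^3 = 2 mod 3. *)
have -> : (- (2%:R * a * psi ^+ 3)) ^+ 3 = - (2%:R * a ^+ 3 * (psi ^+ 3) ^+ 3)
    - 3%:R * (2%:R * a ^+ 3 * (psi ^+ 3) ^+ 3) :> fps 'F_3.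
  by ring.
by rewrite fps_three mul0r subr0; ring.
Qed.

Lemma psi_mul_dissect2 f k : psi * f = k ^+ 3 -> psi * dissect 2 f = psi ^+ 6 * k.
Proof.
move=> fk; rewrite -dissect2_cubeM.
have -> : psi ^+ 3 * f = k ^+ 3 * psi ^+ 2 by rewrite -fk; ring.
by rewrite dissect2_cubeM dissect2_psi_sqr mulrC.
Qed.

Lemma dissect2_thrice_eq0 f h : psi * f = h ^+ 27 ->
  dissect 2 (dissect 2 (dissect 2 f)) = 0.
Proof.
rewrite (exprM h 9 3) => /psi_mul_dissect2.
rewrite (_ : psi ^+ 6 * h ^+ 9 = (psi ^+ 2 * h ^+ 3) ^+ 3); last by ring.
move=> /psi_mul_dissect2.
(* Cancelling one [psi] from psi^8 h^3 leaves a cube times [psi], which has no exponent 2 mod 3. *)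
rewrite (_ : psi ^+ 6 * (psi ^+ 2 * h ^+ 3) = psi * ((psi ^+ 2 * h) ^+ 3 * psi));
    last by ring.
move=> /(mulrI psi_unit) ->.
by rewrite dissect2_cubeM psi2 mulr0.
Qed.

(** In base 3, 26 is 222, so three extractions of the exponents 2 mod 3 send the exponent 27N + 26
    to N. A series in q^27 is a 27th power by taking three cube roots. *)
Lemma coef_26_mod_27_eq0 f h N :
  (forall n, ~~ (27 %| n)%N -> h n = 0) -> psi * f = h -> f (27 * N + 26)%N = 0.
Proof.
move=> h0 fh.
pose c (g : fps 'F_3) : fps 'F_3 := Fps (fun n => g (3 * n)%N).
have hE : h = c (c (c h)) ^+ 27.
  rewrite (exprM _ 3 9) -cube_support; last by move=> n n3; apply: h0; lia.
  rewrite (exprM _ 3 3) -cube_support; last by move=> n n3; apply: h0; lia.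
  by apply: cube_support => n n3; apply: h0; lia.
rewrite hE in fh; have /fpsP/(_ N) := dissect2_thrice_eq0 fh.
by rewrite /= => <-; congr (fps_coef f _); lia.
Qed.
End Cascade.
End CharacteristicThree.

(** * The Jacobi triple product *)

Section ChebyshevThirdKind.
Variable R : comNzRingType.

(* [cheb3 n] evaluated at [x + 1/x] is [(x^(n+1) + x^(-n)) / (x + 1)]; up to
   scaling the variable, these are the Chebyshev polynomials of the third
   kind. *)
Fixpoint cheb3 n : {poly R} :=
  if n is m.+1 then (if m is k.+1 then 'X * cheb3 m - cheb3 k else 'X - 1) else 1.

Lemma cheb3_0 : cheb3 0 = 1. Proof. by []. Qed.
Lemma cheb3_1 : cheb3 1 = 'X - 1. Proof. by []. Qed.
Lemma cheb3SS n : cheb3 n.+2 = 'X * cheb3 n.+1 - cheb3 n.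
Proof. by []. Qed.
Arguments cheb3 : simpl never.

(** Summation by parts from z P_n = P_(n+1) + P_(n-1) and z P_0 = P_1 + P_0; the last two terms are
    the boundary. *)
Lemma sum_cheb3_mulX (d : nat -> R) m :
  \sum_(n < m.+1) (d n.-1 + d n.+1) *: cheb3 n =
  'X * (\sum_(n < m.+1) d n *: cheb3 n) + d m.+1 *: cheb3 m - d m *: cheb3 m.+1.
Proof.
elim: m => [|m IHm]; first by rewrite !big_ord1 /= cheb3_1 cheb3_0 -!mul_polyC; ring.
rewrite big_ord_recr IHm [in RHS]big_ord_recr cheb3SS /= -!mul_polyC; ring.
Qed.
End ChebyshevThirdKind.
Arguments cheb3 : simpl never.

Lemma map_cheb3 (R S : comNzRingType) (f : {rmorphism R -> S}) n :
  map_poly f (cheb3 R n) = cheb3 S n.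
Proof.
elim/ltn_ind: n => -[|[|n]] IHn; first by rewrite !cheb3_0 rmorph1.
  by rewrite !cheb3_1 rmorphB rmorph1 /= map_polyX.
by rewrite !cheb3SS rmorphB rmorphM /= map_polyX !IHn.
Qed.

Section JacobiTripleProduct.
Variable K : comUnitRingType.

Definition qfact k : fps K := \prod_(i < k) (1 - 'q ^+ i.+1).

Lemma qfactS k : qfact k.+1 = qfact k * (1 - 'q ^+ k.+1).
Proof. exact: big_ord_recr. Qed.

Lemma qfact0 : qfact 0 = 1.
Proof. exact: big_ord0. Qed.

Lemma qfact_unit k : qfact k \is a GRing.unit.
Proof.
rewrite unitr_prod // => i _; rewrite fps_unitE fps_coefD fps_coefN fps_coefXn.
by rewrite subr0 unitr1.
Qed.

(** A congruence modulo q^(i+1): each additional factor is 1 - q^k with k > i. *)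
Lemma qfactD i j : exists b, qfact (i + j) = qfact i * (1 + 'q ^+ i.+1 * b).
Proof.
elim: j => [|j [b IHj]]; first by exists 0; rewrite addn0; ring.
exists (b - 'q ^+ j * (1 + 'q ^+ i.+1 * b)).
by rewrite addnS qfactS IHj -addSn exprD; ring.
Qed.

(* The recursion multiplies by [1 + z q^(l+1) + q^(2(l+1))] in the basis
   [cheb3]. For [n = 0] the term [jacobi_coef l n.-1] is [jacobi_coef l 0],
   which is right because [z * cheb3 0 = cheb3 1 + cheb3 0]. *)
Fixpoint jacobi_coef m n : fps K :=
  if m is l.+1 then
    (1 + 'q ^+ (2 * l.+1)) * jacobi_coef l n
    + 'q ^+ l.+1 * (jacobi_coef l n.-1 + jacobi_coef l n.+1)
  else (n == 0%N)%:R.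

Lemma jacobi_coef_eq0 m n : (m < n)%N -> jacobi_coef m n = 0.
Proof.
elim: m n => [|m IHm] n mn /=; first by rewrite gtn_eqF.
rewrite !IHm; try lia.
by rewrite addr0 !mulr0 addr0.
Qed.

(* That is, [jacobi_coef m n] is the Gaussian binomial [2m+1, m-n] times
   [q^tri n], in a form without division. *)
Lemma jacobi_coefE m n : (n <= m)%N ->
  jacobi_coef m n * (qfact (m - n) * qfact (m + n).+1) =
  qfact (2 * m).+1 * 'q ^+ tri n.
Proof.
elim: m n => [|m IHm] n nm.
  have -> : n = 0%N by lia.
  by rewrite expr0 mulr1 [LHS]mul1r qfact0 mul1r.
(* In terms of q, x and y, the three contributions [mid], [up] and [down] to the recursion share the
   factor [qfact (2 * m).+1 * 'q ^+ tri n], and their sum becomes a polynomial identity. *)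
pose x : fps K := 'q ^+ (m.+1 - n); pose y : fps K := 'q ^+ n.
have xy : 'q ^+ m.+1 = x * y by rewrite -exprD; congr ('q ^+ _); lia.
have mid : jacobi_coef m n * (qfact (m.+1 - n) * qfact (m + n).+1) =
    (1 - x) * (qfact (2 * m).+1 * 'q ^+ tri n).
  have [nm'|mn] := leqP n m.
    by rewrite -IHm // /x subSn // qfactS; ring.
  by rewrite jacobi_coef_eq0 // /x (_ : m.+1 - n = 0)%N ?expr0; [ring | lia].
have up : 'q ^+ m.+1 * (jacobi_coef m n.+1 * (qfact (m.+1 - n) * qfact (m + n).+2)) =
    (1 - x) * (x * y ^+ 2 * ('q - x)) * (qfact (2 * m).+1 * 'q ^+ tri n).
  have [nm'|mn] := ltnP n m.
    have IH := IHm _ nm'; rewrite addnS triS exprD exprS -/y in IH.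
    have xE : x = 'q * 'q ^+ (m - n) by rewrite -exprS /x subSn // ltnW.
    have mE : (m - n = (m - n.+1).+1)%N by lia.
    transitivity (x * y * ((jacobi_coef m n.+1 *
        (qfact (m - n.+1) * qfact (m + n).+2)) * ((1 - 'q ^+ (m - n)) * (1 - x)))).
      rewrite xy subSn 1?ltnW // qfactS mE qfactS -mE -subSn 1?ltnW // -/x; ring.
    by rewrite IH xE; ring.
  (* At the edge the right-hand side vanishes too: x = q if n = m, and x = 1 if n = m + 1. *)
  rewrite jacobi_coef_eq0 ?ltnS // mul0r mulr0.
  have [mnE|nE] : (m = n \/ n = m.+1)%N by lia.
    by rewrite /x mnE subSn // subnn expr1; ring.
  by rewrite /x nE subnn expr0; ring.
have down : 'q ^+ m.+1 * (jacobi_coef m n.-1 * (qfact (m.+1 - n) * qfact (m + n).+2)) =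
    x * (1 - x * y ^+ 2) * (1 - 'q * x * y ^+ 2) * (qfact (2 * m).+1 * 'q ^+ tri n).
  have q1 : 'q ^+ (m + n).+1 = x * y ^+ 2.
    by rewrite -addSn exprD xy; rewrite /y; ring.
  have q2 : 'q ^+ (m + n).+2 = 'q * x * y ^+ 2 by rewrite exprS q1; ring.
  rewrite qfactS q2 xy; case: n nm @x @y xy mid up q1 q2 => [|n] nm x y xy mid up q1 q2.
    have IH := IHm _ (leq0n m); rewrite subn0 addn0 in IH *.
    have y1 : y = 1 by rewrite /y expr0.
    by rewrite -IH qfactS xy y1; ring.
  rewrite subSS qfactS q1 /= triS exprD -/y.
  have IH := IHm n nm; rewrite -addnS in IH.
  transitivity (x * y * (1 - x * y ^+ 2) * (1 - 'q * x * y ^+ 2) *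
      (jacobi_coef m n * (qfact (m - n) * qfact (m + n.+1)))).
    by ring.
  by rewrite IH; ring.
have q2m : 'q ^+ (2 * m.+1) = x ^+ 2 * y ^+ 2 by rewrite mulnC exprM xy; ring.
have QE : qfact (2 * m.+1).+1 =
    qfact (2 * m).+1 * (1 - x ^+ 2 * y ^+ 2) * (1 - 'q * (x ^+ 2 * y ^+ 2)).
  have e : (2 * m.+1 = (2 * m).+2)%N by lia.
  by rewrite qfactS exprS q2m {1}e qfactS -e q2m.
rewrite QE addSn /= q2m.
transitivity ((1 + x ^+ 2 * y ^+ 2) * (1 - 'q * x * y ^+ 2) *
    (jacobi_coef m n * (qfact (m.+1 - n) * qfact (m + n).+1))
  + 'q ^+ m.+1 * (jacobi_coef m n.-1 * (qfact (m.+1 - n) * qfact (m + n).+2))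
  + 'q ^+ m.+1 * (jacobi_coef m n.+1 * (qfact (m.+1 - n) * qfact (m + n).+2))).
  have q2 : 'q ^+ (m + n).+2 = 'q * x * y ^+ 2.
    by rewrite exprS -addSn exprD xy; rewrite /y; ring.
  by rewrite (qfactS (m + n).+1) q2; ring.
by rewrite mid up down; ring.
Qed.

(** This replaces the limit in m. The quotients [qfact (2 * m).+1 / qfact (m + n).+1] and
    [qfact m / qfact (m - n)] are 1 modulo q^(m+n+2) and q^(m-n+1); the factor q^(tri n), with tri n
    >= n, raises the error to q^(m+1). *)
Lemma qfact_jacobi_coef m n : (n <= m)%N ->
  exists h, qfact m * jacobi_coef m n = 'q ^+ tri n + 'q ^+ m.+1 * h.
Proof.
move=> nm; have JE := jacobi_coefE nm.
have [a aE] := qfactD (m + n).+1 (m - n).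
have [b bE] := qfactD (m - n) n; rewrite subnK // in bE.
rewrite (_ : (m + n).+1 + (m - n) = (2 * m).+1)%N in aE; last by lia.
have JE' : jacobi_coef m n * qfact (m - n) = (1 + 'q ^+ (m + n).+2 * a) * 'q ^+ tri n.
  by apply: (mulrI (qfact_unit (m + n).+1)); rewrite [RHS]mulrA -aE -JE; ring.
exists ('q ^+ n.+1 * a * (1 + 'q ^+ (m - n).+1 * b)
    * 'q ^+ tri n + 'q ^+ (tri n - n) * b).
rewrite bE mulrAC [_ * jacobi_coef m n]mulrC JE'.
have -> : 'q ^+ (m + n).+2 = 'q ^+ m.+1 * 'q ^+ n.+1 :> fps K.
  by rewrite -exprD addSn addnS.
have qT : 'q ^+ m.+1 * 'q ^+ (tri n - n) = 'q ^+ (m - n).+1 * 'q ^+ tri n :> fps K.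
  by rewrite -!exprD; congr ('q ^+ _); have := leq_tri n; lia.
rewrite [X in _ = _ + X]mulrDr [X in _ + (_ + X)]mulrA qT; ring.
Qed.

Definition jacobi_prod m : {poly fps K} :=
  \prod_(k < m) ((1 + 'q ^+ (2 * k.+1))%:P + 'q ^+ k.+1 *: 'X).

Lemma jacobi_prodE m :
  jacobi_prod m = \sum_(n < m.+1) jacobi_coef m n *: cheb3 (fps K) n.
Proof.
elim: m => [|m IHm]; first by rewrite /jacobi_prod big_ord0 big_ord1 /= scale1r.
rewrite /jacobi_prod big_ord_recr /= -/(jacobi_prod m) IHm.
(* With one more zero term in the sum, both boundary terms of [sum_cheb3_mulX] vanish. *)
have widen : \sum_(n < m.+1) jacobi_coef m n *: cheb3 (fps K) n =
    \sum_(n < m.+2) jacobi_coef m n *: cheb3 (fps K) n.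
  by rewrite [RHS]big_ord_recr /= jacobi_coef_eq0 // scale0r addr0.
have := sum_cheb3_mulX (jacobi_coef m) m.+1.
rewrite widen !jacobi_coef_eq0 // !scale0r addr0 subr0 => XE.
rewrite mulrDr -scalerAr [_ * 'X]mulrC -XE mulrC mul_polyC !scaler_sumr -big_split.
by apply: eq_bigr => n _; rewrite /= !scalerA -scalerDl.
Qed.
End JacobiTripleProduct.

Lemma fps_coefMz (f : fps int) (z : int) n : (f * z%:~R) n = f n * z.
Proof.
have N k : (f * k%:R) n = f n * k%:Z.
  elim: k => [|k IHk]; first by rewrite !mulr0.
  by rewrite -natr1 mulrDr fps_coefD mulr1 IHk -addn1 PoszD mulrDr mulr1.
case: z => k; first exact: N.
by rewrite NegzE mulrNz mulrN fps_coefN N mulrN.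
Qed.

Lemma qfact_jacobi_prod m t k : (k <= m)%N ->
  (qfact int m * (jacobi_prod int m)`_t) k = theta (fun n => (cheb3 int n)`_t) k.
Proof.
move=> km; rewrite (theta_widen _ km) jacobi_prodE coef_sum mulr_sumr.
have coef_sumE (F : 'I_m.+1 -> fps int) : (\sum_n F n) k = \sum_n F n k.
  by apply: (big_morph (fun f : fps int => f k)).
rewrite coef_sumE; apply: eq_bigr => n _; rewrite coefZ mulrA.
have [|h ->] := @qfact_jacobi_coef int m n; first by rewrite -ltnS.
(* The coefficients of [cheb3] over the series ring are constant series. *)
rewrite -(map_cheb3 (intr : {rmorphism int -> fps int})) coef_map fps_coefMz.
by rewrite fps_coefD fps_coefXnM ltnNge km addr0 fps_coefXn mulrC.
Qed.

(** * The series of MacMahon *)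

Section ElementarySymmetric.
Variables (S : comNzRingType) (u : nat -> S).

(** The monomials are sorted by the smallest index b that they involve. *)
Lemma coef_prod_chain m t a :
  (\prod_(a.+1 <= j < m) (1 + u j *: 'X))`_t.+1 =
  \sum_(a.+1 <= b < m) u b * (\prod_(b.+1 <= j < m) (1 + u j *: 'X))`_t.
Proof.
have [k] := ubnP (m - a); elim: k a => // k IHk a mk.
have [ma|am] := leqP m a.+1; first by rewrite !big_geq // coef1.
rewrite big_ltn // [RHS]big_ltn // -IHk; last lia.
by rewrite mulrDl mul1r coefD -scalerAl coefZ coefXM /= addrC.
Qed.

Lemma coef_prod_tuple m t a :
  (\prod_(a.+1 <= j < m) (1 + u j *: 'X))`_t =
  \sum_(v : t.-tuple 'I_m | path ltn a (map val v)) \prod_(x <- v) u x.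
Proof.
elim: t a => [|t IHt] a.
  rewrite (big_pred1 [tuple]); last by move=> v; rewrite tuple0.
  rewrite big_nil -horner_coef0 horner_prod big1 // => j _.
  by rewrite hornerD hornerZ hornerX mulr0 addr0 hornerC.
rewrite coef_prod_chain (big_nat_widenl _ 0) // big_mkord.
under eq_bigr => b _ do rewrite IHt big_distrr /=.
rewrite pair_big_dep (reindex (fun p : 'I_m * t.-tuple 'I_m => [tuple of p.1 :: p.2])).
  by apply: eq_big => [[b v]|[b v] _] //=; rewrite big_cons.
exists (fun v => (thead v, [tuple of behead v])) => [[b v] _|v _] /=.
  by rewrite theadE; congr pair; apply/val_inj.
by rewrite [RHS]tuple_eta; apply/val_inj.
Qed.
End ElementarySymmetric.

Section MacMahonCoefficients.
Variable a : int.

Definition MO_factor (j : nat) : fps int := 'q ^+ j / MO_denom a j.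

Lemma MO_term_prod t (w : t.-tuple nat) :
  MO_index w -> MO_term a w = \prod_(x <- w) MO_factor x.
Proof.
move=> wP; have w0 k : (0 < tnth w k)%N.
  by have /allP/(_ _ (mem_tnth k w)) := order_path_min ltn_trans wP.
rewrite /MO_term expr_sum -prodrV; last by move=> k _; apply: MO_denom_unit.
by rewrite -big_split big_tuple.
Qed.

(** An entry above m pushes the exponent of q beyond k, so the infinite sum reduces to tuples with
    entries at most m. *)
Lemma MO_coef_tuple t m k : (k <= m)%N ->
  MO a t k = (\sum_(v : t.-tuple 'I_m.+1 | path ltn 0 (map val v))
                \prod_(x <- v) MO_factor x) k.
Proof.
move=> km; pose g (v : t.-tuple 'I_m.+1) : t.-tuple nat := [tuple of map val v].
have g_inj : injective g.
  by move=> v1 v2 /(congr1 val)/= /(inj_map val_inj) v12; apply/val_inj.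
rewrite /MO /MO_gf /fps_sum.
transitivity (\sum_(w <- map g (enum {: t.-tuple 'I_m.+1}) | path ltn 0%N w) MO_term a w k).
  have -> : @MO_index t = [set` (fun w : t.-tuple nat => path ltn 0%N w)]%classic.
    by apply/seteqP; split.
  rewrite /=; symmetry; apply: bigfs => [|w wP wm]; first by
      rewrite map_inj_uniq ?enum_uniq.
  apply: MO_term_coef_eq0; rewrite ltnNge; apply/negP => wk.
  case/mapP: wm; exists [tuple inord (tnth w i) | i < t]; first by rewrite mem_enum.
  apply: eq_from_tnth => i; rewrite tnth_map tnth_mktuple /= inordK // ltnS.
  by rewrite (leq_trans _ km) // (leq_trans _ wk) // (bigD1 i) //= leq_addr.
rewrite big_map big_enum_cond.
rewrite (big_morph (fun f : fps int => f k) (id1 := 0) (op1 := +%R)) //.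
by apply: eq_big => // v /andP[_ vP]; rewrite MO_term_prod // big_map.
Qed.

Lemma MO_coef_prod t m k : (k <= m)%N ->
  MO a t k = ((\prod_(j < m) (1 + MO_factor j.+1 *: 'X))`_t) k.
Proof.
move=> km; rewrite (MO_coef_tuple _ km) -coef_prod_tuple big_add1 /=.
by rewrite big_mkord.
Qed.
End MacMahonCoefficients.

Lemma fps_eq_coefM (K : comNzRingType) (f g h : fps K) m :
  (forall k, (k <= m)%N -> f k = g k) ->
  forall k, (k <= m)%N -> (h * f) k = (h * g) k.
Proof.
move=> fg k km; rewrite !fps_coefM; apply: eq_bigr => i _.
by rewrite fg // (leq_trans (leq_subr _ _)).
Qed.

(** Each factor is its value at z = 0, namely [MO_denom 0 j.+1], times
    [1 + MO_factor 0 j.+1 *: 'X]. *)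
Lemma jacobi_prod_MO m t :
  (jacobi_prod int m)`_t =
  (jacobi_prod int m)`_0 * (\prod_(j < m) (1 + MO_factor 0 j.+1 *: 'X))`_t.
Proof.
have D0 j : MO_denom 0 j.+1 = 1 + 'q ^+ (2 * j.+1).
  by rewrite /MO_denom mulr0z mul0r addr0.
have -> : (jacobi_prod int m)`_0 = \prod_(j < m) MO_denom 0 j.+1.
  rewrite -horner_coef0 horner_prod; apply: eq_bigr => j _.
  by rewrite hornerD hornerZ hornerX mulr0 addr0 hornerC D0.
rewrite -coefCM; congr ((polyseq _)`_t); rewrite rmorph_prod -big_split /jacobi_prod /=.
apply: eq_bigr => j _; rewrite mulrDr mulr1 -scalerAr mul_polyC scalerA.
by rewrite divrK ?MO_denom_unit // D0.
Qed.

Definition theta_coef t (n : nat) : int := (cheb3 int n)`_t.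

(** At q^k all products may be cut at k; [qfact k] then turns the coefficients of z^0 and z^t into
    psi and Theta_t up to q^k. *)
Lemma theta_MO t : theta (theta_coef 0) * Fps (MO 0 t) = theta (theta_coef t).
Proof.
apply/fpsP => k; rewrite -(@qfact_jacobi_prod k) // jacobi_prod_MO.
rewrite mulrA; set G := (polyseq (\prod_(j < k) _))`_t.
rewrite (@fps_eq_coefM _ _ G _ k) //; last first.
  by move=> i ik; apply: MO_coef_prod.
rewrite ![_ * G]mulrC; apply: (@fps_eq_coefM _ _ _ _ k) => // i ik.
by rewrite (qfact_jacobi_prod _ ik).
Qed.

(** * Coefficients of the polynomials [cheb3] and their support modulo 3 *)

Lemma coef_shift_diff (K : comNzRingType) p (v : fps K) n :
  ('q ^+ p * v - 'q ^+ p.+1 * v) n =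
  (if (p <= n)%N then v (n - p)%N else 0) - (if (p < n)%N then v (n - p.+1)%N else 0).
Proof. by rewrite fps_coefD fps_coefN !fps_coefXnM. Qed.

Section ChebyshevGeneratingFunction.
Variable K : comUnitRingType.

(** The variable is the y of the overview: it marks the index n instead of the exponent tri n. *)
Definition cheb3_gf t : fps K := Fps (fun n => (cheb3 K n)`_t).

Lemma cheb3_gf0 : (1 + 'q ^+ 2) * cheb3_gf 0 = 1 - 'q.
Proof.
apply/fpsP => k; rewrite mulrDl mul1r !(fps_coefD, fps_coefXnM, fps_coefN, fps_coef1).
case: k => [|[|k]] /=; rewrite ?cheb3_0 ?cheb3_1 ?cheb3SS.
- by rewrite coef1 addr0 subr0.
- by rewrite coefB coefX coef1 addr0.
- by rewrite coefB coefXM subSS subSS subn0 addrNK subr0.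
Qed.

Lemma cheb3_gfS t : (1 + 'q ^+ 2) * cheb3_gf t.+1 = 'q * cheb3_gf t.
Proof.
apply/fpsP => k; rewrite mulrDl mul1r !(fps_coefD, fps_coefXnM, fps_coefXM).
case: k => [|[|k]] /=; rewrite ?cheb3_0 ?cheb3_1 ?cheb3SS.
- by rewrite coef1 addr0.
- by rewrite coefB coefX !coef1 subr0 addr0.
- by rewrite coefB coefXM subSS subSS subn0 addrNK.
Qed.

Lemma cheb3_gfE t : (1 + 'q ^+ 2) ^+ t.+1 * cheb3_gf t = 'q ^+ t * (1 - 'q).
Proof.
elim: t => [|t IHt]; first by rewrite expr1 cheb3_gf0 mul1r.
by rewrite (exprSr _ t.+1) -mulrA cheb3_gfS mulrCA IHt mulrA -exprS.
Qed.

(** For t = (p+1)J + p, t + 1 = (p+1)(J+1), so the denominator in [cheb3_gfE] is a (p+1)st power,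
    and q^t is q^p times one. *)
Lemma cheb3_gf_power p J : exists w,
  cheb3_gf (p.+1 * J + p) = 'q ^+ p * w ^+ p.+1 - 'q ^+ p.+1 * w ^+ p.+1.
Proof.
pose c : fps K := (1 + 'q ^+ 2) ^+ J.+1.
have cU : c \is a GRing.unit.
  by rewrite unitrX // fps_unitE fps_coefD fps_coefXn addr0 unitr1.
exists (c^-1 * 'q ^+ J).
apply: (mulrI (unitrX p.+1 cU)).
rewrite -mulrBl mulrCA -(exprMn _ c) mulrA divrr // mul1r -exprM.
rewrite /c -exprM (_ : J.+1 * p.+1 = (p.+1 * J + p).+1)%N; last by lia.
by rewrite cheb3_gfE exprD (mulnC J) exprS; ring.
Qed.
End ChebyshevGeneratingFunction.

(** Mod 3, w^27 is a series in q^27, so q^26 w^27 and q^27 w^27 only have exponents 26 and 0 mod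
    27. *)
Lemma cheb3_mod3_support J n :
  ~~ (27 %| n)%N -> ~~ (27 %| n.+1)%N -> (cheb3 'F_3 n)`_(27 * J + 26) = 0.
Proof.
have [w wE] := cheb3_gf_power 'F_3 26 J.
have w0 i : ~~ (27 %| i)%N -> (w ^+ 27) i = 0.
  move=> i27; rewrite (exprM _ 9 3) fps_coef_cube; case: ifP => // i3.
  rewrite (exprM _ 3 3) fps_coef_cube; case: ifP => // i9.
  rewrite fps_coef_cube ifF //; lia.
move: (w ^+ 27) w0 wE => v v0 /(congr1 (fun g : fps _ => g n)) vE n0 n1.
apply: etrans vE _; rewrite coef_shift_diff.
by do 2![case: leqP => ?]; rewrite ?v0 ?subr0 //; lia.
Qed.

(** * Reduction of theta series modulo 3 and the dissection of [psi] *)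

Lemma intr_theta (R : comNzRingType) (c : nat -> int) k :
  (theta c k)%:~R = theta (fun n => (c n)%:~R : R) k.
Proof.
by rewrite /= rmorph_sum; apply: eq_bigr => n _; rewrite rmorphM /= rmorph_nat.
Qed.

(** A triangular number is 1 mod 3 only for n = 3k + 1, and tri (3k+1) = 9 tri k + 1. *)
Lemma tri_eq1_mod3 n m : tri n = (3 * m + 1)%N ->
  exists2 k, n = (3 * k + 1)%N & m = (3 * tri k)%N.
Proof.
move=> nm; have := double_tri n; rewrite nm.
have := divn_eq n 3; have := ltn_pmod n (isT : 0 < 3)%N.
move: (n %/ 3)%N (n %% 3)%N => k r r3 nE n2.
by exists k; have := double_tri k; case: r r3 nE n2 => [|[|[|]]] // _ ->; lia.
Qed.

Section ThetaConstant.
Variable R : comNzRingType.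

(* In the usual notation for Ramanujan's theta functions this is psi(-q). *)
Definition psi : fps R := theta (fun n => (cheb3 R n)`_0).

Lemma cheb3_coef0SS n : (cheb3 R n.+2)`_0 = - (cheb3 R n)`_0.
Proof. by rewrite cheb3SS coefB coefXM sub0r. Qed.

(** Raising k by 2 raises 3k + 1 by 6: three sign changes on the left against one on the right. *)
Lemma cheb3_coef0_3n1 k : (cheb3 R (3 * k + 1))`_0 = - (cheb3 R k)`_0.
Proof.
elim/ltn_ind: k => -[|[|k]] IHk.
- by rewrite cheb3_1 cheb3_0 coefB coefX coef1 sub0r.
- by rewrite !cheb3_coef0SS cheb3_0 cheb3_1 coefB coefX !coef1 sub0r opprK.
have -> : (3 * k.+2 + 1 = (3 * k + 1).+2.+2.+2)%N by lia.
by rewrite !cheb3_coef0SS IHk // !opprK.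
Qed.

Lemma psi_coef_3m1 m :
  psi (3 * m + 1)%N = if (3 %| m)%N then - psi (m %/ 3)%N else 0.
Proof.
have [[k mE]|no] := pselect (exists k, m = 3 * tri k)%N.
  rewrite mE dvdn_mulr // mulKn
      // theta_tri -cheb3_coef0_3n1 -(theta_tri (fun n => (cheb3 R n)`_0)).
  congr (fps_coef psi _); have := double_tri k; have := double_tri (3 * k + 1); lia.
rewrite /psi theta_eq0; last by move=> n /esym/tri_eq1_mod3[k _ mE]; case: no; exists k.
case: ifP => // m3; rewrite theta_eq0 ?oppr0 // => n mn.
by case: no; exists n; lia.
Qed.

Lemma psi_coef_3m2 m : psi (3 * m + 2)%N = 0.
Proof.
apply: theta_eq0 => n mn; exfalso.
have := double_tri n; rewrite -mn.
have := divn_eq n 3; have := ltn_pmod n (isT : 0 < 3)%N.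
by move: (n %/ 3)%N (n %% 3)%N => k [|[|[|]]] // _ ->; lia.
Qed.

Lemma psi_coef0 : psi 0%N = 1.
Proof. by rewrite -[0%N]/(tri 0) theta_tri cheb3_0 coef1. Qed.
End ThetaConstant.

Theorem theorem7p1 (J N : nat) :
  (MO 0%R (27 * J + 26)%N (27 * N + 26)%N = 0 %[mod 3])%Z.
Proof.
set t := (27 * J + 26)%N.
pose f : fps 'F_3 := Fps (fun n => (MO 0 t n)%:~R).
have intr_coef s n : (theta_coef s n)%:~R = (cheb3 'F_3 n)`_s.
  by rewrite -(map_cheb3 (intr : {rmorphism int -> 'F_3})) coef_map.
have thetaE s k : (theta (theta_coef s) k)%:~R = theta (fun n => (cheb3 'F_3 n)`_s) k.
  by rewrite intr_theta; congr (fps_coef (theta _) k); apply/funext => n.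
have psi_f : psi 'F_3 * f = theta (fun n => (cheb3 'F_3 n)`_t).
  apply/fpsP => k; rewrite -thetaE -theta_MO !fps_coefM rmorph_sum.
  by apply: eq_bigr => i _; rewrite [RHS]intrM thetaE.
have psi1 : dissect 1 (psi 'F_3) = - psi 'F_3 ^+ 3.
  apply/fpsP => m; rewrite fps_coefN fps_coef_cube; apply: etrans (psi_coef_3m1 _ m) _.
  by case: ifP; rewrite ?oppr0.
have psi2 : dissect 2 (psi 'F_3) = 0 by apply/fpsP => m; apply: psi_coef_3m2.
have psi_unit : psi 'F_3 \is a GRing.unit by rewrite fps_unitE psi_coef0 unitr1.
have fN : f (27 * N + 26)%N = 0.
  (* If 27 divides n or n + 1, it divides n(n+1) = 2 tri n, hence tri n; so Theta_t is a series in
     q^27 mod 3. *)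
  apply: (coef_26_mod_27_eq0 psi1 psi2 psi_unit _ _ psi_f) => k k27.
  apply: theta_eq0 => n kn; apply: cheb3_mod3_support; apply/negP => /dvdnP[c nE];
    case/negP: k27; have := double_tri n; rewrite -kn nE ?nE.
    by have : (c * 27 * (c * 27).+1 = 27 * (c * (c * 27).+1))%N; lia.
  by have : (n * (c * 27) = 27 * (n * c))%N; lia.
apply/eqP; rewrite eqz_mod_dvd subr0.
have p3 : 3%N \in [pchar 'F_3] by apply: pchar_Fp.
by rewrite (dvdz_pcharf p3) /=; apply/eqP.
Qed.
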